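(* Let $m\ge1$, let $T$ be the $m$-adic rooted tree, and let $G\le\mathrm{Aut}~T$ be a contracting automata group given by an invertible finite-state automaton with alphabet $\{1,\dots,m\}$ and set of states $S$, so that $G=\langle o_s : s\in S\rangle$. Assume that: (i) the non-finitary states in $S$ are fully connected; (ii) the contracting nucleus of $G$ is contained in $\{o_s : s\in S\}$. Then every non-finitary $g\in G$ is cyclic in $G$, i.e. $\langle g\rangle^{\mathrm{SS}}=G$, and every finitely generated self-similar proper subgroup of $G$ is finite.
   Context: Tree. The $m$-adic tree $T$ is identified with the free monoid of finite words over $X=\{1,\dots,m\}$ (root = empty word $\emptyset$); the $n$th level is the set of words of length $n$. $\mathrm{Aut}~T$ is the group of root-fixing, adjacency-preserving bijections of the vertices, acting on the right as $v\mapsto v^g$ (products are composed from left to right). The section $g|_v\in\mathrm{Aut}~T$ is the unique automorphism with $(vu)^g=v^gu^{g|_v}$ for all $u\in T$; the label of $g$ at $v$ is the permutation of $X$ that $g|_v$ induces on the first level. An automorphism is finitary if there is $n$ such that all its labels at levels $k\ge n$ are trivial. A subgroup $K\le\mathrm{Aut}~T$ is self-similar if $g|_v\in K$ for all $g\in K$, $v\in T$. For $G$ self-similar and $H\le G$, the self-similar closure $H^{\mathrm{SS}}$ is the intersection of all self-similar subgroups $K$ with $H\le K\le G$. An element $g\in G$ is cyclic in $G$ (in the discrete sense) if $\langle g\rangle^{\mathrm{SS}}=G$. Automata. An invertible finite-state automaton is a quadruple $(S,X,t,o)$ with finite sets $S$ (states) and $X$ (alphabet), a transition function $t:X\times S\to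 S$ and an output function $o:X\times S\to X$ with $o(-,s)\in\mathrm{Sym}(X)$ for all $s\in S$. These are extended to words by $t(\emptyset,s)=s$, $o(\emptyset,s)=\emptyset$, $t(xv,s)=t(v,t(x,s))$ and $o(xv,s)=o(x,s)\,o(v,t(x,s))$; then $o_s:T\to T$, $v\mapsto o(v,s)$, is an element of $\mathrm{Aut}~T$. The associated automata group is $\langle o_s: s\in S\rangle\le \mathrm{Aut}~T$. View the automaton as a directed graph with vertex set $S$ and an edge $s\to t(x,s)$ for each $x\in X$, $s\in S$; a state is fully connected if there is a directed path from it to every other state. A state $s$ is finitary if $o_s$ is finitary. Contraction. For $g\in G$ let $|g|$ be its word length with respect to the finite generating set $\{o_s: s\in S\}$, and let $l_n(g)$ be the maximum of the lengths of the sections of $g$ at the vertices of level $n$. $G$ is contracting if there are constants $C,N\ge1$ and $\lambda<1$ such that $l_n(g)\le\lambda|g|+C$ for every $n\ge N$ and every $g\in G$. In this case there is a finite subset of $G$ such that for every $g\in G$ there is a level beyond which all sections of $g$ lie in this subset; the contracting nucleus of $G$ is the smallest such subset. *)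

(* Defs.v *)
From HB Require Import structures.
From mathcomp Require Import all_boot all_order perm all_algebra.
From mathcomp Require Import boolp classical_sets cardinality reals.

Set Implicit Arguments.
Unset Strict Implicit.
Unset Printing Implicit Defensive.

Import Order.TTheory GRing.Theory Num.Theory.
Local Open Scope classical_set_scope.
Local Open Scope group_scope.

(* The vertices of the m-adic tree; the alphabet {1, ..., m} is 'I_m. *)
Definition word (m : nat) := seq 'I_m.

Definition adjacent (m : nat) (v w : word m) : Prop :=
  exists x, w = rcons v x \/ v = rcons w x.

Record tree_aut (m : nat) := TreeAut {
  aut_fun :> word m -> word m;
  aut_bij : bijective aut_fun;
  aut_root : aut_fun [::] = [::];
  aut_adj : forall v w, adjacent v w -> adjacent (aut_fun v) (aut_fun w) }.

Section TreeAut.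
Variable m : nat.
Implicit Types (g h : tree_aut m) (u v w : word m).

Lemma tree_aut_ext g h : g =1 h -> g = h.
Proof.
case: g h => [g gb g0 ga] [h hb h0 ha] /= /funext gh; subst h.
by congr TreeAut; apply: Prop_irrelevance.
Qed.

Lemma aut_inj g : injective g.
Proof. exact/bij_inj/aut_bij. Qed.

Lemma aut_rcons_size g v :
  size (g v) = size v /\ forall x, exists y, g (rcons v x) = rcons (g v) y.
Proof.
elim/last_ind: v => [|v x [sv IHv]].
  split=> [|x]; rewrite aut_root //.
  have [|y [->|/esym/(congr1 size)]] := @aut_adj _ g [::] [:: x].
  - by exists x; left.
  - by exists y; rewrite aut_root.
  - by rewrite aut_root size_rcons.
have [y gy] := IHv x; split; first by rewrite gy !size_rcons sv.
move=> z; have [|y' [->|]] := @aut_adj _ g (rcons v x) (rcons (rcons v x) z).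
- by exists z; left.
- by exists y'.
rewrite gy => /rcons_inj[/aut_inj/(congr1 size)].
by rewrite !size_rcons; elim: (size v) => // n IHn [].
Qed.

Lemma size_aut g v : size (g v) = size v.
Proof. by case: (aut_rcons_size g v). Qed.

Lemma aut_rcons g v x : exists y, g (rcons v x) = rcons (g v) y.
Proof. by case: (aut_rcons_size g v). Qed.

Lemma aut_cat g v u : exists u', g (v ++ u) = g v ++ u'.
Proof.
elim/last_ind: u => [|u x [u' eu]]; first by exists [::]; rewrite !cats0.
have [y ey] := aut_rcons g (v ++ u) x.
by exists (rcons u' y); rewrite -!rcons_cat ey eu.
Qed.

Lemma tree_aut_of (f : word m -> word m) : bijective f -> f [::] = [::] ->
  (forall v x, exists y, f (rcons v x) = rcons (f v) y) ->
  exists g : tree_aut m, g =1 f.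
Proof.
move=> fb f0 fr.
have fa v w : adjacent v w -> adjacent (f v) (f w).
  move=> [x [->|->]]; first by have [y ->] := fr v x; exists y; left.
  by have [y ->] := fr w x; exists y; right.
by exists (TreeAut fb f0 fa).
Qed.

Lemma aut_id_ex : exists g, g =1 id.
Proof.
apply: tree_aut_of => //; first by exists id.
by move=> v x; exists x.
Qed.
Definition aut_one := projT1 (cid aut_id_ex).

(* Automorphisms act on the right: v ^ (g h) = (v ^ g) ^ h. *)
Lemma aut_mul_ex g h : exists k : tree_aut m, k =1 h \o g.
Proof.
apply: tree_aut_of => [||v x].
- exact: bij_comp (aut_bij h) (aut_bij g).
- by rewrite /= aut_root aut_root.
- have [y /= ->] := aut_rcons g v x.
  by have [z ->] := aut_rcons h (g v) y; exists z.
Qed.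
Definition aut_mul g h := projT1 (cid (aut_mul_ex g h)).

Lemma aut_inv_ex g : exists h : tree_aut m, cancel g h /\ cancel h g.
Proof.
have [f gK fK] := aut_bij g.
have [|||h hf] := @tree_aut_of f.
- by exists g.
- by rewrite -{1}(aut_root g) gK.
- move=> w y; have := fK (rcons w y).
  case: (lastP (f (rcons w y))) => [|v x].
    by rewrite aut_root => /(congr1 size); rewrite size_rcons.
  have [y' ->] := aut_rcons g v x => /rcons_inj[<- _].
  by exists x; rewrite gK.
by exists h; split=> v; rewrite hf ?gK ?fK.
Qed.
Definition aut_inv g := projT1 (cid (aut_inv_ex g)).

Lemma aut_oneE v : aut_one v = v.
Proof. by rewrite /aut_one; case: cid => g /= ->. Qed.

Lemma aut_mulE g h v : aut_mul g h v = h (g v).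
Proof. by rewrite /aut_mul; case: cid => k /= ->. Qed.

Lemma aut_invK g : cancel g (aut_inv g).
Proof. by rewrite /aut_inv; case: cid => h /= []. Qed.

Lemma aut_invKV g : cancel (aut_inv g) g.
Proof. by rewrite /aut_inv; case: cid => h /= []. Qed.

HB.instance Definition _ := gen_eqMixin (tree_aut m).
HB.instance Definition _ := gen_choiceMixin (tree_aut m).

Fact aut_mulA : associative aut_mul.
Proof. by move=> f g h; apply: tree_aut_ext => v; rewrite !aut_mulE. Qed.

Fact aut_mul1 : left_id aut_one aut_mul.
Proof. by move=> g; apply: tree_aut_ext => v; rewrite aut_mulE aut_oneE. Qed.

Fact aut_mulr1 : right_id aut_one aut_mul.
Proof. by move=> g; apply: tree_aut_ext => v; rewrite aut_mulE aut_oneE. Qed.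

Fact aut_mulV : left_inverse aut_one aut_inv aut_mul.
Proof.
by move=> g; apply: tree_aut_ext => v; rewrite aut_mulE aut_oneE aut_invKV.
Qed.

Fact aut_mulrV : right_inverse aut_one aut_inv aut_mul.
Proof.
by move=> g; apply: tree_aut_ext => v; rewrite aut_mulE aut_oneE aut_invK.
Qed.

HB.instance Definition _ := isGroup.Build (tree_aut m)
  aut_mulA aut_mul1 aut_mulr1 aut_mulV aut_mulrV.

Lemma aut1E v : (1 : tree_aut m) v = v.
Proof. exact: aut_oneE. Qed.

Lemma autME g h v : (g * h) v = h (g v).
Proof. exact: aut_mulE. Qed.

Lemma autK g : cancel g g^-1.
Proof. exact: aut_invK. Qed.

Lemma autVK g : cancel g^-1 g.
Proof. exact: aut_invKV. Qed.

Lemma section_ex g v :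
  exists h : tree_aut m, forall u, g (v ++ u) = g v ++ h u.
Proof.
pose f g v u := drop (size v) (g (v ++ u)).
have fE (k : tree_aut m) w u : k (w ++ u) = k w ++ f k w u.
  by rewrite /f; have [u' ->] := aut_cat k w u; rewrite -(size_aut k) drop_size_cat.
have fK (k : tree_aut m) w : cancel (f k w) (f k^-1 (k w)).
  move=> u; have := congr1 k^-1 (fE k w u).
  by rewrite autK fE autK => /eqP; rewrite eqseq_cat // => /andP[_ /eqP].
have [|||h hE] := @tree_aut_of (f g v).
- exists (f g^-1 (g v)); first exact: fK.
  by have := fK g^-1 (g v); rewrite autK (invgK g).
- by rewrite /f cats0 drop_oversize ?size_aut.
- move=> u x; have [y ey] := aut_rcons g (v ++ u) x; exists y.
  by rewrite {1}/f -rcons_cat ey drop_rcons // size_aut size_cat leq_addr.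
by exists h => u; rewrite hE fE.
Qed.

(* The section of g at v. *)
Definition section g v : tree_aut m := projT1 (cid (section_ex g v)).

Lemma sectionE g v u : g (v ++ u) = g v ++ section g v u.
Proof. by rewrite /section; case: cid. Qed.

Lemma section_unique g v h : (forall u, g (v ++ u) = g v ++ h u) -> h = section g v.
Proof.
move=> hE; apply: tree_aut_ext => u; apply/eqP.
by have /eqP := hE u; rewrite sectionE eqseq_cat // eqxx eq_sym.
Qed.

Definition label_fun g v x : 'I_m := head x (section g v [:: x]).

Lemma label_funE g v x : section g v [:: x] = [:: label_fun g v x].
Proof.
by rewrite /label_fun; case: (section g v _) (size_aut (section g v) [:: x]) => [|? []].
Qed.

Lemma label_fun_inj g v : injective (label_fun g v).
Proof.
move=> x y exy; have /aut_inj[] // : section g v [:: x] = section g v [:: y].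
by rewrite !label_funE exy.
Qed.

Definition label g v : {perm 'I_m} := perm (@label_fun_inj g v).

Lemma labelE g v x : section g v [:: x] = [:: label g v x].
Proof. by rewrite permE label_funE. Qed.

Definition finitary g : Prop :=
  exists n : nat, forall v, (n <= size v)%N -> label g v = 1.

End TreeAut.

Section Subgroups.
Variable m : nat.
Implicit Types (G H K F : set (tree_aut m)) (g : tree_aut m).

Definition is_subgroup K : Prop :=
  [/\ K 1, (forall g h, K g -> K h -> K (g * h)) & (forall g, K g -> K g^-1)].

Definition generated F : set (tree_aut m) := smallest is_subgroup F.

Definition finitely_generated H : Prop :=
  exists F, finite_set F /\ H = generated F.

Definition self_similar K : Prop := forall g v, K g -> K (section g v).

(* H^SS, relative to the ambient group G. *)
Definition ss_closure G H : set (tree_aut m) :=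
  smallest (fun K => [/\ is_subgroup K, self_similar K & K `<=` G]) H.

Definition cyclic_in G g : Prop := ss_closure G (generated [set g]) = G.

End Subgroups.

Record automaton (m : nat) (S : finType) := Automaton {
  trans : 'I_m -> S -> S;
  out : 'I_m -> S -> 'I_m;
  out_bij : forall s, bijective (out^~ s) }.

Section Automata.
Variables (m : nat) (S : finType) (A : automaton m S).
Implicit Types (s : S) (v w : word m) (g : tree_aut m) (N : set (tree_aut m)).

Fixpoint trans_word v s : S :=
  if v is x :: v' then trans_word v' (trans A x s) else s.

Fixpoint out_word v s : word m :=
  if v is x :: v' then out A x s :: out_word v' (trans A x s) else [::].

Lemma trans_word_cat v w s :
  trans_word (v ++ w) s = trans_word w (trans_word v s).
Proof. by elim: v s => /=. Qed.

Lemma out_word_cat v w s :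
  out_word (v ++ w) s = out_word v s ++ out_word w (trans_word v s).
Proof. by elim: v s => //= x v IHv s; rewrite IHv. Qed.

Lemma state_aut_ex s : exists g : tree_aut m, g =1 out_word^~ s.
Proof.
apply: tree_aut_of => // [|v x]; last first.
  by exists (out A x (trans_word v s)); rewrite -!cats1 out_word_cat.
have oV s' : exists f, cancel (out A ^~ s') f /\ cancel f (out A ^~ s').
  by have [f ? ?] := out_bij A s'; exists f.
have [f fP] := choice oV.
pose fix inv w s' {struct w} : word m :=
  if w is y :: w' then f s' y :: inv w' (trans A (f s' y) s') else [::].
exists (inv^~ s) => v; elim: v s => //= x v IHv s.
  by rewrite (fP s).1 IHv.
by rewrite (fP s).2 IHv.
Qed.

(* The automorphism o_s. *)
Definition state_aut s : tree_aut m := projT1 (cid (state_aut_ex s)).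

Lemma state_autE s v : state_aut s v = out_word v s.
Proof. by rewrite /state_aut; case: cid => g /= ->. Qed.

Definition states : set (tree_aut m) := range state_aut.

Definition automaton_group : set (tree_aut m) := generated states.

Definition edge : rel S := [rel s s' | [exists x, trans A x s == s']].

Definition fully_connected s : Prop :=
  forall s', s' != s -> connect edge s s'.

Definition spells g (p : seq (tree_aut m)) : Prop :=
  (forall h, h \in p -> states h \/ states h^-1) /\ g = \prod_(h <- p) h.

Definition is_length g (n : nat) : Prop :=
  (exists p, spells g p /\ size p = n) /\
  forall p, spells g p -> (n <= size p)%N.

(* |g|; the default value 0 is only used outside of the automaton group. *)
Definition word_length g : nat := xget 0%N [set n | is_length g n].

Lemma word_lengthP g : automaton_group g -> is_length g (word_length g).
Proof.
move=> Gg; apply: xgetPex.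
have [p pg] : exists p, spells g p.
  apply: (Gg (fun h => exists p, spells h p)); split; last first.
    move=> h Sh; exists [:: h]; split; last by rewrite big_seq1.
    by move=> k; rewrite mem_seq1 => /eqP->; left.
  split=> [|h k [p [hp ->]] [q [hq ->]]|h [p [hp ->]]].
  - by exists [::]; split=> //; rewrite big_nil.
  - exists (p ++ q); split; last by rewrite big_cat.
    by move=> l; rewrite mem_cat => /orP[/hp|/hq].
  exists (rev (map (fun k => k^-1) p)); split.
    move=> k; rewrite mem_rev => /mapP[l /hp hl ->]; rewrite invgK.
    by case: hl; [right|left].
  elim: p {hp} => [|k p IHp]; first by rewrite !big_nil invg1.
  by rewrite big_cons invgM IHp /= rev_cons -cats1 big_cat big_seq1.
pose P n := `[< exists p, spells g p /\ size p = n >].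
have exP : exists n, P n by exists (size p); apply/asboolP; exists p.
case: (ex_minnP exP) => n /asboolP Pn minn; exists n; split=> // q sq.
by apply: minn; apply/asboolP; exists q.
Qed.

Definition level_length (n : nat) g : nat :=
  (\max_(v : n.-tuple 'I_m) word_length (section g v))%N.

Definition contracting (R : realType) : Prop :=
  exists (C lambda : R) (N : nat),
    [/\ (1 <= C)%R, (1 <= N)%N, (lambda < 1)%R &
    forall n g, (N <= n)%N -> automaton_group g ->
      ((level_length n g)%:R <= lambda * (word_length g)%:R + C)%R].

Definition absorbing N : Prop :=
  [/\ finite_set N, N `<=` automaton_group &
  forall g, automaton_group g ->
    exists n : nat, forall v, (n <= size v)%N -> N (section g v)].

(* The smallest absorbing set, whenever absorbing sets exist: see nucleusP. *)
Definition nucleus : set (tree_aut m) := \bigcap_(N in absorbing) N.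

Lemma nucleusP N : absorbing N -> absorbing nucleus.
Proof.
move=> aN; have [Nfin NG Nabs] := aN; split.
- by apply: sub_finite_set Nfin; apply: bigcap_inf.
- by move=> g /(_ _ aN)/NG.
move=> g Gg; have [s defN] := (finite_seqP N).1 Nfin.
have [n0 n0P] := Nabs g Gg.
have [n nP] : exists n : nat, forall v, (n <= size v)%N ->
    section g v \in s -> nucleus (section g v).
  elim: s {defN} => [|x s [n nP]]; first by exists 0%N.
  have [Nx|/existsNP[M /not_implyP[aM nMx]]] := pselect (nucleus x).
    by exists n => v vn; rewrite inE => /orP[/eqP->|/(nP v vn)].
  have [_ _ /(_ g Gg)[k kP]] := aM.
  exists (maxn n k) => v; rewrite geq_max => /andP[vn vk].
  rewrite inE => /orP[/eqP gx|]; last exact: nP.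
  by case: nMx; rewrite -gx; apply: kP.
exists (maxn n0 n) => v; rewrite geq_max => /andP[vn0 vn].
by apply: nP => //; have := n0P v vn0; rewrite defN.
Qed.

End Automata.

(* Main.v *)
Require Import Defs.
From mathcomp Require Import all_boot all_order perm all_algebra.
From mathcomp Require Import boolp classical_sets cardinality reals.
From mathcomp Require Import zify lra.
Local Open Scope classical_set_scope.

(** The whole argument is that a non-finitary element can be steered, by taking
    sections, to a non-finitary state, and from there to every state.

    Contraction makes word lengths of sections drop until they are at most a
    constant depending only on the group (word_length_section_bounded); the
    ball of that radius is finite, so it absorbs all deep sections and the
    nucleus, being the smallest absorbing set, absorbs them too.  By hypothesis
    (ii), the deep sections of any g in G are therefore states.  If g is not
    finitary, then at every level some section of g is not finitary either
    (nonfinitary_section), for otherwise the finitely many depths at that level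
    would bound the depth of g.  Hence some section of g is a non-finitary
    state; it is fully connected by (i), and moving along an edge of the
    automaton is taking a section, so a self-similar subgroup containing g
    contains all states, that is, all of G.

    For the second claim, a proper self-similar subgroup can thus contain only
    finitary elements.  The automorphisms of depth at most n form a group, which
    is finite because such an automorphism is determined by its action on words
    of length at most n.  Finitely many finitary generators have a common depth,
    so the subgroup that they generate lies in such a finite group. *)

Section SelfSimilarGroups.
Import Order.TTheory GRing.Theory Num.Theory.
Local Open Scope group_scope.
Set Implicit Arguments.
Unset Strict Implicit.

Lemma uniform_bound (T : eqType) (P : T -> nat -> Prop) (s : seq T) :
    (forall x n k, (n <= k)%N -> P x n -> P x k) ->
    (forall x, x \in s -> exists n, P x n) ->
  exists n, forall x, x \in s -> P x n.
Proof.
move=> mono; elim: s => [|x s IHs] exP; first by exists 0%N.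
have [y ys|n nP] := IHs; first by apply: exP; rewrite inE ys orbT.
have [k kP] := exP x (mem_head x s); exists (maxn n k) => y.
rewrite inE => /orP[/eqP->|/nP]; first exact: mono (leq_maxr _ _) kP.
exact: mono (leq_maxl _ _).
Qed.

Variable m : nat.
Implicit Types (g h : tree_aut m) (u v w : word m) (F H K : set (tree_aut m)).

(** * Sections and depth *)

Lemma section1 v : section (1 : tree_aut m) v = 1.
Proof. by apply/esym/section_unique => u; rewrite !aut1E. Qed.

Lemma sectionM g h v : section (g * h) v = section g v * section h (g v).
Proof. by apply/esym/section_unique => u; rewrite !autME !sectionE. Qed.

Lemma sectionV g v : section g^-1 v = (section g (g^-1 v))^-1.
Proof.
apply: (mulgI (section g (g^-1 v))).
by rewrite mulgV -[X in section g^-1 X](autVK g v) -sectionM mulgV section1.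
Qed.

Lemma section_cat g v w : section g (v ++ w) = section (section g v) w.
Proof. by apply/esym/section_unique => u; rewrite -catA !sectionE catA. Qed.

Lemma label_cat g v w : label g (v ++ w) = label (section g v) w.
Proof.
by apply/permP => x; have := labelE g (v ++ w) x; rewrite section_cat labelE => -[].
Qed.

Lemma label_trivial g : (forall v, label g v = 1) -> g = 1.
Proof.
move=> g1; apply: tree_aut_ext; elim/last_ind => [|v x IHv].
  by rewrite !aut_root.
by rewrite -cats1 sectionE labelE g1 perm1 IHv !aut1E.
Qed.

Definition depth_le n : set (tree_aut m) :=
  [set g | forall v, (n <= size v)%N -> section g v = 1].

Lemma depth_le_mono g n k : (n <= k)%N -> depth_le n g -> depth_le k g.
Proof. by move=> nk gn v kv; apply/gn/(leq_trans nk). Qed.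

Lemma finitaryP g : finitary g <-> exists n, depth_le n g.
Proof.
split=> -[n gn]; exists n => v nv; last first.
  by rewrite -[v]cats0 label_cat gn //; apply/permP => x; rewrite perm1;
     have := labelE (1 : tree_aut m) [::] x; rewrite section1 aut1E => -[].
apply: label_trivial => u; rewrite -label_cat gn // size_cat.
exact: leq_trans nv (leq_addr _ _).
Qed.

Lemma depth_le_subgroup n : is_subgroup (depth_le n).
Proof.
split=> [v _|g h gn hn v nv|g gn v nv]; first exact: section1.
- by rewrite sectionM gn // hn ?size_aut // mulg1.
- by rewrite sectionV gn ?size_aut // invg1.
Qed.

(** An automorphism of depth at most n only rewrites the prefix of length n of
    a word, so its restriction to the finitely many words of length at most n
    determines it. *)
Lemma depth_le_finite n : finite_set (depth_le n).
Proof.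
have gP g (b : n.-bseq 'I_m) : (size (g b) <= n)%N.
  by rewrite size_aut size_bseq.
pose r g := [ffun b : n.-bseq 'I_m => Bseq (gP g b)].
suff r_inj : {in depth_le n &, injective r}.
  by rewrite -(eq_finite_set (inj_card_eq r_inj)); apply: finite_finset.
move=> g h; rewrite !inE => gn hn /ffunP rgh; apply: tree_aut_ext => v.
have tn : (size (take n v) <= n)%N by rewrite size_take_min geq_minl.
have := congr1 val (rgh (Bseq tn)); rewrite !ffunE /= => gh.
have [nv|vn] := leqP n (size v); last by rewrite take_oversize // ltnW in gh.
rewrite -(cat_take_drop n v) !sectionE gh.
by rewrite gn ?hn // size_takel.
Qed.

(** If the finitely many sections at level n were finitary, a common bound on
    their depths would, increased by n, bound the depth of g. *)
Lemma nonfinitary_section g n : ~ finitary g ->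
  exists v, size v = n /\ ~ finitary (section g v).
Proof.
move=> gF; apply: contrapT => noex; apply: gF; apply/finitaryP.
have [||k kP] := @uniform_bound _
    (fun v : n.-tuple 'I_m => depth_le^~ (section g v)) (enum {: n.-tuple 'I_m}).
- by move=> v; apply: depth_le_mono.
- move=> v _; apply/finitaryP; apply: contrapT => vF; apply: noex.
  by exists v; rewrite size_tuple.
exists (n + k)%N => v nkv.
have nv : (n <= size v)%N := leq_trans (leq_addr _ _) nkv.
have tn : size (take n v) == n by rewrite size_takel.
rewrite -(cat_take_drop n v) section_cat (kP (Tuple tn)) ?mem_enum //.
by rewrite size_drop leq_subRL.
Qed.

(** * Automata groups *)

Lemma generated_subgroup F : is_subgroup (generated F).
Proof.
split=> [K KF|g h gF hF K KF|g gF K KF]; have [[K1 KM KV] _] := KF.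
- exact: K1.
- exact: KM (gF K KF) (hF K KF).
- exact: KV (gF K KF).
Qed.

Variables (S : finType) (A : automaton m S).
Notation G := (automaton_group A).

Lemma section_state s v :
  section (state_aut A s) v = state_aut A (trans_word A v s).
Proof.
by apply/esym/section_unique => u; rewrite !state_autE out_word_cat.
Qed.

Lemma automaton_group_subgroup : is_subgroup G.
Proof. exact: generated_subgroup. Qed.

Lemma automaton_group_self_similar : self_similar G.
Proof.
move=> g v Gg; move: v; have [G1 GM GV] := automaton_group_subgroup.
apply: (Gg [set h | forall v, G (section h v)]); split; first split.
- by move=> v; rewrite section1.
- by move=> h k Gh Gk v; rewrite sectionM; exact: GM (Gh _) (Gk _).
- by move=> h Gh v; rewrite sectionV; exact: GV (Gh _).
- move=> _ [s _ <-] v K [_]; rewrite section_state; apply.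
  by exists (trans_word A v s).
Qed.

(** An edge from s to t(x, s) exhibits o_{t(x, s)} as the section of o_s at x. *)
Lemma connect_section s s' : connect (edge A) s s' ->
  exists v, section (state_aut A s) v = state_aut A s'.
Proof.
move=> /connectP[p]; elim: p s => [|t p IHp] s /=.
  by move=> _ ->; exists [::]; rewrite section_state.
move=> /andP[/existsP[x /eqP <-]] /IHp/[apply] -[v ev].
by exists (x :: v); rewrite -ev !section_state.
Qed.

(** * Contraction *)

(** Elements of length at most n are products of sequences of at most n letters
    from the finite alphabet of signed states. *)
Lemma word_length_ball_finite n :
  finite_set [set g | G g /\ (word_length A g <= n)%N].
Proof.
pose f (a : S * bool) := if a.2 then state_aut A a.1 else (state_aut A a.1)^-1.
pose F (b : n.-bseq (S * bool)) := \prod_(a <- b) f a.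
apply: (@sub_finite_set _ _ (range F)) => [g [Gg]|]; last exact: finite_image.
have [[p [[pS ->] <-]] _] := word_lengthP Gg.
suff [q <- eq] : exists2 q : seq (S * bool), size q = size p &
    \prod_(h <- p) h = \prod_(a <- q) f a.
  by move=> qn; exists (Bseq qn).
elim: p pS => [|h p IHp] pS; first by exists [::]; rewrite ?big_nil.
have [k kp|q sq eq] := IHp; first by apply: pS; rewrite inE kp orbT.
have [a ha] : exists a, h = f a.
  have [[s _ hs]|[s _ hs]] := pS h (mem_head _ _); first by exists (s, true).
  by exists (s, false); rewrite /f /= hs invgK.
by exists (a :: q); rewrite /= ?sq // !big_cons eq ha.
Qed.

(** With M at least C and (C + 1) / (1 - lambda), the map x |-> lambda * x + C
    takes values at most M on [0, M], whatever the sign of lambda, and lowers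
    each x > M by at least 1.  Taking sections at level N thus brings the length
    to at most M in finitely many rounds, and once it is at most M, all sections
    at levels from N on have length at most M. *)
Lemma word_length_section_bounded (R : realType) : contracting A R ->
  exists M, forall g, G g -> exists n, forall v, (n <= size v)%N ->
    (word_length A (section g v) <= M)%N.
Proof.
move=> [C [l [N [C1 _ l1 lN]]]].
(* The sum of the two lower bounds wanted for M, each being nonnegative. *)
have [M [MC Ml]] : exists M : nat, (C <= M%:R /\ C + 1 <= (1 - l) * M%:R)%R.
  have l0 : (0 < 1 - l)%R by lra.
  have D0 : (0 <= (C + 1) / (1 - l))%R by apply: divr_ge0; lra.
  exists (Num.bound (C + (C + 1) / (1 - l)))%R.
  have DM : (C + (C + 1) / (1 - l) < (Num.bound (C + (C + 1) / (1 - l)))%:R)%R.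
    by apply: archi_boundP; lra.
  split; first lra.
  by rewrite mulrC -ler_pdivrMr //; lra.
have step g v : G g -> (N <= size v)%N ->
    (word_length A (section g v) <= maxn M (word_length A g).-1)%N.
  move=> Gg Nv; have := lN _ _ Nv Gg.
  have : (word_length A (section g v) <= level_length A (size v) g)%N.
    exact: (leq_bigmax (F := fun w : (size v).-tuple 'I_m =>
      word_length A (section g w)) (in_tuple v)).
  rewrite -(ler_nat R) leq_max.
  set k := word_length A g; set y := word_length A _ => yl ll.
  have [kM|Mk] := leqP k M.
    apply/orP; left; rewrite -(ler_nat R).
    move: kM (ler0n R k); rewrite -(ler_nat R) => kM k0.
    have [l0|l0] := lerP 0 l; nra.
  apply/orP; right; suff : (y + 1 <= k)%N by lia.
  by move: Mk; rewrite -(ltr_nat R) -(ler_nat R) natrD => Mk; nra.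
exists M => g Gg; have [k] := ubnP (word_length A g).
elim: k g Gg => // k IHk g Gg gk.
have [gM|gM] := leqP (word_length A g) M.
  exists N => v /(step g v Gg) /leq_trans-> //; rewrite geq_max leqnn.
  exact: leq_trans (leq_pred _) gM.
have [||n nP] := @uniform_bound _ (fun (v : N.-tuple 'I_m) n =>
    forall w, (n <= size w)%N ->
    (word_length A (section (section g v) w) <= M)%N) (enum {: N.-tuple 'I_m}).
- by move=> v n n' nn' nP w n'w; apply/nP/(leq_trans nn').
- move=> v _; apply: IHk; first exact: automaton_group_self_similar.
  have := step g v Gg; rewrite size_tuple leqnn => /(_ isT).
  move=> /leq_ltn_trans; apply; rewrite gtn_max (leq_trans gM) //=.
  by move: gk gM; lia.
exists (N + n)%N => v Nnv.
have Nv : (N <= size v)%N := leq_trans (leq_addr _ _) Nnv.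
have tN : size (take N v) == N by rewrite size_takel.
rewrite -(cat_take_drop N v) section_cat (nP (Tuple tN)) ?mem_enum //.
by rewrite size_drop leq_subRL.
Qed.

Lemma contracting_nucleus (R : realType) :
  contracting A R -> absorbing A (nucleus A).
Proof.
move=> /word_length_section_bounded[M MP].
apply: (@nucleusP _ _ _ [set g | G g /\ (word_length A g <= M)%N]); split.
- exact: word_length_ball_finite.
- by move=> g [].
- move=> g Gg; have [n nP] := MP g Gg; exists n => v /nP; split=> //.
  exact: automaton_group_self_similar.
Qed.

(** * Self-similar subgroups *)

(** Deep sections of g are states by the hypothesis on the nucleus, and one of
    them is not finitary; from such a state, walking in the automaton is taking
    sections, so K reaches every generator. *)
Lemma self_similar_nonfinitary_full (R : realType) K g :
    contracting A R ->
    (forall s, ~ finitary (state_aut A s) -> fully_connected A s) ->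
    nucleus A `<=` states A ->
    is_subgroup K -> self_similar K -> G g -> ~ finitary g -> K g ->
  G `<=` K.
Proof.
move=> Ac Afc nucS Ksub Kss Gg gF Kg.
have [_ _ /(_ g Gg)[n nP]] := contracting_nucleus Ac.
have [v [vn vF]] := nonfinitary_section n gF.
have [|s _ sv] := nucS (section g v); first by apply: nP; rewrite vn.
have Ks : K (state_aut A s) by rewrite sv; apply: Kss.
move=> h; apply; split=> // _ [t _ <-].
have [->//|ts] := eqVneq t s.
have [|w <-] := @connect_section s t; last exact: Kss.
by apply: Afc; rewrite // sv.
Qed.

End SelfSimilarGroups.

Theorem theorem3p10 (R : realType) (m : nat) (hm : (1 <= m)%N) (S : finType)
    (A : automaton m S) (G : set (tree_aut m))
    (hG : G = automaton_group A)
    (hcontr : contracting A R)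
    (hconn : forall s : S, ~ finitary (state_aut A s) -> fully_connected A s)
    (hnuc : nucleus A `<=` states A) :
  (forall g : tree_aut m, G g -> ~ finitary g -> cyclic_in G g) /\
  (forall H : set (tree_aut m), is_subgroup H -> H `<=` G ->
     self_similar H -> finitely_generated H -> H <> G -> finite_set H).
Proof.
subst G; have GK := self_similar_nonfinitary_full hcontr hconn hnuc.
have Gsub := automaton_group_subgroup A.
have Gss := @automaton_group_self_similar _ _ A.
split=> [g Gg gF|H Hsub HG Hss [F [Ffin HF]] HneG].
  rewrite /cyclic_in eqEsubset; split.
    apply: smallest_sub; first by split=> // h v; apply: Gss.
    by apply: smallest_sub; [exact: Gsub|move=> _ ->].
  move=> h Gh K [[Ksub Kss _] gK]; apply: (GK K g) => //.
  by apply: gK => L [_]; apply.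
have Hfin h : H h -> finitary h.
  move=> Hh; apply: contrapT => hF; apply: HneG; rewrite eqEsubset; split=> //.
  by apply: (GK H h) => //; apply: HG.
have [s Fs] := (finite_seqP F).1 Ffin.
have [||n nP] := @uniform_bound _ (fun h n => depth_le n h) s.
- by move=> h n k; apply: depth_le_mono.
- move=> h hs; apply/finitaryP/Hfin; rewrite HF => K [_]; apply; rewrite Fs.
  exact: hs.
apply: sub_finite_set (depth_le_finite m n); rewrite HF.
apply: smallest_sub; first exact: depth_le_subgroup.
by rewrite Fs.
Qed.
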